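(* Let $H$ be an instance hypergraph of MTRS-minDist (as described in the context) such that: (i) $|\Delta|=|R|$ and for every $\eta\in\Delta$ and every $r\in R$, $\{\eta,r\}$ is an edge of $H$; (ii) $w(e)\ge 1$ for every edge $e$; (iii) the edges are closed under nonempty subsets of riders and weights are monotone under this (see context); and (iv) $\lambda=\max_{\eta\in D}\lambda_\eta\ge 2$. Let $M$ be the solution output by Algorithm GreedyMinDist and $M^*$ an optimal solution of MTRS-minDist. Then $$\frac{w(M)}{w(M^* )}\le\frac{\lambda^2\mu+\lambda}{\lambda+1},\qquad\text{where } \mu=\frac{\max_{e\in E(H)}w(e)}{\min_{e\in E(H)}w(e)}.$$
   Context: An instance of MTRS-minDist: finite sets $R$ (riders) and $D=\Gamma\cup\Delta$ (drivers, personal and designated, $\Gamma\cap\Delta=\emptyset$), each driver $\eta$ with capacity $\lambda_\eta\ge1$; a hypergraph $H$ with vertex set $D\cup R$ whose edges (feasible matches) are sets $\{\eta\}\cup S$ with $\eta\in D$, $\emptyset\neq S\subseteq R$, $|S|\le\lambda_\eta$, each edge $e$ having an integer weight $w(e)$; for $e=\{\eta\}\cup S$ write $D(e)=\eta$, $R(e)=S$; for a set $M$ of edges $w(M)=\sum_{e\in M}w(e)$. Closure: if $\{\eta\}\cup S$ is an edge with $|S|\ge2$ then $\{\eta\}\cup S'$ is an edge for every nonempty $S'\subseteq S$. Monotonicity: for edges $e,e'$ with $D(e)=D(e')$ and $R(e')\subseteq R(e)$, $w(e')\le w(e)$. A feasible solution is a set of pairwise vertex-disjoint edges covering every rider; an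 optimal solution is a feasible solution of minimum total weight. Algorithm GreedyMinDist computes two sets $M_1,M_2$ and outputs $M\in\{M_1,M_2\}$ with $w(M)=\min\{w(M_1),w(M_2)\}$. $M_1$: start with $M_1=\emptyset$ and the original $H$; repeatedly select an edge $e$ of the current hypergraph with minimum $w(e)$, add it to $M_1$, and delete all vertices of $e$ and all edges containing a vertex of $e$; stop when every rider is covered by $M_1$. $M_2$: the same procedure starting from the original $H$, but selecting in each iteration an edge minimizing $w(e)/|R(e)|$. *)

(* Defs.v *)
From HB Require Import structures.
From mathcomp Require Import all_boot all_order all_algebra.

Set Implicit Arguments.
Unset Strict Implicit.
Unset Printing Implicit Defensive.

Import Order.TTheory GRing.Theory Num.Theory.
Local Open Scope ring_scope.

(* The edge {eta} :|: S of the hypergraph on the vertex set D + R is encoded by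
   the pair (eta, S); so D(e) is e.1 and R(e) is e.2. *)
Notation edge D R := (D * {set R})%type.

(* [weight] is total, but only its values on [edges] are ever used. *)
Record instance (D R : finType) := Instance {
  personal : {set D};
  designated : {set D};
  drivers_cover : personal :|: designated = [set: D];
  drivers_disjoint : [disjoint personal & designated];
  capacity : D -> nat;
  capacity_gt0 : forall eta, (1 <= capacity eta)%N;
  edges : {set edge D R};
  edges_nonempty : forall e, e \in edges -> e.2 != set0;
  edges_capacity : forall e, e \in edges -> (#|e.2| <= capacity e.1)%N;
  weight : edge D R -> int
}.

Section MinDist.
Variables (D R : finType) (I : instance D R).
Implicit Types (e f : edge D R) (E M : {set edge D R}).

Definition closed_edges : Prop :=
  forall eta (S S' : {set R}), (eta, S) \in edges I -> (2 <= #|S|)%N ->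
    S' != set0 -> S' \subset S -> (eta, S') \in edges I.

Definition monotone_weight : Prop :=
  forall e e', e \in edges I -> e' \in edges I -> e.1 = e'.1 ->
    e'.2 \subset e.2 -> weight I e' <= weight I e.

Definition vertex_disjoint e f : bool := (e.1 != f.1) && [disjoint e.2 & f.2].

Definition total_weight M : int := \sum_(e in M) weight I e.

Definition covers_riders M : bool := [forall r, exists e in M, r \in e.2].

Definition feasible M : Prop :=
  [/\ M \subset edges I,
      {in M &, forall e f, e != f -> vertex_disjoint e f}
    & covers_riders M].

Definition optimal M : Prop :=
  feasible M /\ forall M', feasible M' -> total_weight M <= total_weight M'.

(* [greedy_from key E M M'] : with [E] the edges of the current hypergraph and
   [M] the edges selected so far, some run (ties are broken arbitrarily) stops
   with [M'].  Deleting the vertices of the selected edge [e] and the edges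
   meeting them leaves the edges of [E] that are vertex-disjoint from [e]. *)
Inductive greedy_from (key : edge D R -> rat) E M :
    {set edge D R} -> Prop :=
| greedy_stop : covers_riders M -> greedy_from key E M M
| greedy_step e M' :
    ~~ covers_riders M ->
    e \in E -> (forall f, f \in E -> key e <= key f) ->
    greedy_from key [set f in E | vertex_disjoint e f] (e |: M) M' ->
    greedy_from key E M M'.

Definition greedy (key : edge D R -> rat) M : Prop :=
  greedy_from key (edges I) set0 M.

Definition weight_key e : rat := (weight I e)%:~R.
Definition ratio_key e : rat := (weight I e)%:~R / #|e.2|%:R.

Definition greedy_minDist M : Prop :=
  exists M1 M2, [/\ greedy weight_key M1, greedy ratio_key M2,
    M = M1 \/ M = M2
    & total_weight M = Num.min (total_weight M1) (total_weight M2)].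

Definition max_capacity : nat := (\max_(eta : D) capacity I eta)%N.

(* The value 0 is a dummy for a hypergraph without edges, which under the
   requirement that every designated driver and rider form an edge only occurs
   when there are no riders. *)
Definition max_weight : int :=
  if [pick e in edges I] is Some e0
  then weight I [arg max_(e > e0 in edges I) weight I e]%O else 0.
Definition min_weight : int :=
  if [pick e in edges I] is Some e0
  then weight I [arg min_(e < e0 in edges I) weight I e]%O else 0.

Definition weight_spread : rat := max_weight%:~R / min_weight%:~R.

End MinDist.

(* Main.v *)
(** Choosing edges of minimum weight alone achieves the ratio.  Fix an optimal
solution N.  As long as the driver of f in N is free and f has an uncovered
rider, the closure and monotonicity assumptions leave a residual edge of weight
at most w(f), which bounds the weight of the edge selected next.  Once another
edge has taken the driver, each leftover rider of f costs at most the maximum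
weight b; but the edge taking it has itself covered a rider.  Balancing the two
effects, every rider of an f whose driver is free is priced at max(w(f), y) with
y = (L b + a) / (L + 1), where a is the minimum weight and L the maximum
capacity.  The potential summing these prices and the cost of losing the drivers
starts at no more than rho w(N), where rho = L y / a is the claimed ratio, and
each step lowers it by at least the weight of the selected edge. *)
Require Import Defs.
From mathcomp Require Import all_boot all_order all_algebra.
From mathcomp Require Import ring lra.

Set Implicit Arguments.
Unset Strict Implicit.
Unset Printing Implicit Defensive.

Import Order.TTheory GRing.Theory Num.Theory.
Local Open Scope ring_scope.

(** * Arithmetic of the price [y] and the ratio [rho] *)

Section Prices.
Context (F : realFieldType) (a b L rho y : F).
Hypotheses (a_gt0 : 0 < a) (le_ab : a <= b) (L_ge1 : 1 <= L).
Hypotheses (yE : (L + 1) * y = L * b + a) (rhoE : rho * a = L * y).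

Let L_ge0 : 0 <= L. Proof. by move: L_ge1; lra. Qed.
Let L1_gt0 : 0 < L + 1. Proof. by move: L_ge1; lra. Qed.

Lemma price_ge_min : a <= y.
Proof.
by rewrite -(ler_pM2l L1_gt0) yE mulrDl mul1r lerD2r ler_wpM2l.
Qed.

Lemma price_le_max : y <= b.
Proof. by rewrite -(ler_pM2l L1_gt0) yE mulrDl mul1r lerD2l. Qed.

Lemma ratio_ge : L <= rho.
Proof. by rewrite -(ler_pM2r a_gt0) rhoE ler_wpM2l ?price_ge_min. Qed.

(** If [w <= y], then [L * y = rho * a <= rho * w]; otherwise [L <= rho] suffices. Hence [rho * w]
    can fund [L] rider slots. *)
Lemma slot_le_ratio w : a <= w -> L * Num.max w y <= rho * w.
Proof.
move=> le_aw; have w_ge0 : 0 <= w by move: a_gt0; lra.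
case: (leP w y) => _; last by rewrite ler_wpM2r ?ratio_ge.
by rewrite -rhoE ler_wpM2l // (le_trans L_ge0) ?ratio_ge.
Qed.

(** Since [rho >= 1], the worst case is [w = a], where equality holds: there [yE] reads
    [L * y - a = L * b - y]. This balance dictates the choice of [y]. *)
Lemma kill_le_ratio w : a <= w -> L * b + w - y <= rho * w.
Proof.
move=> le_aw; have rho1_ge0 : 0 <= rho - 1.
  by move: ratio_ge L_ge1; lra.
have := ler_wpM2l rho1_ge0 le_aw.
move: yE; rewrite (mulrDl L) !(mulrBl _ rho) !mul1r rhoE; lra.
Qed.

End Prices.

(** * The hypergraph left after some selections, and the extreme weights *)

Section Residual.
Context {D R : finType} (I : instance D R).
Implicit Types (e f g : D * {set R}) (M N : {set D * {set R}}).

Definition used_drivers M : {set D} := [set g.1 | g in M].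
Definition covered_riders M : {set R} := \bigcup_(g in M) g.2.
Definition uncovered M f : {set R} := f.2 :\: covered_riders M.

Definition residual_edges M : {set D * {set R}} :=
  [set f in edges I | [forall g in M, vertex_disjoint g f]].

Lemma residual_edgesP M f :
  reflect [/\ f \in edges I, f.1 \notin used_drivers M
            & [disjoint f.2 & covered_riders M]] (f \in residual_edges M).
Proof.
rewrite inE; apply: (iffP andP) => [[fI /forall_inP disj]|[fI unused disj]].
  split=> //.
    by apply/imsetP=> -[g /disj /andP[/eqP neq _] /esym].
  rewrite disjoint_sym disjoint_subset; apply/bigcupsP=> g /disj /andP[_].
  by rewrite disjoint_subset.
split=> //; apply/forall_inP=> g gM; apply/andP; split.
  by apply: contra unused => /eqP <-; apply: imset_f.
rewrite disjoint_sym; apply: disjointWr disj.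
exact: bigcup_sup.
Qed.

Lemma residual_edges0 : residual_edges set0 = edges I.
Proof.
apply/setP=> f; rewrite inE; case: (f \in edges I) => //=.
by apply/forall_inP=> g; rewrite inE.
Qed.

Lemma residual_edgesU1 e M :
  [set f in residual_edges M | vertex_disjoint e f] = residual_edges (e |: M).
Proof.
apply/setP=> f; rewrite !inE -andbA; congr andb.
apply/andP/forall_inP => [[/forall_inP disj ef] g|disj].
  by rewrite !inE => /predU1P[->|/disj].
split; last by apply: disj; rewrite !inE eqxx.
by apply/forall_inP=> g gM; apply: disj; rewrite !inE gM orbT.
Qed.

Lemma used_driversU1 e M : used_drivers (e |: M) = e.1 |: used_drivers M.
Proof. exact: imsetU1. Qed.

Lemma card_uncoveredU1 e M f : [disjoint e.2 & covered_riders M] ->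
  #|uncovered M f| = (#|uncovered (e |: M) f| + #|f.2 :&: e.2|)%N.
Proof.
move=> disj; rewrite -(cardsID e.2 (uncovered M f)) addnC; congr (_ + _)%N.
  apply: eq_card => r.
  by rewrite /uncovered /covered_riders bigcup_setU big_set1 !inE negb_or andbA.
apply: eq_card => r; rewrite !inE.
case: (boolP (r \in e.2)) => [re|_]; last by rewrite !andbF.
by rewrite (disjointFr disj re) andbT.
Qed.

Lemma total_weightU1 e M : e \in residual_edges M ->
  total_weight I (e |: M) = weight I e + total_weight I M.
Proof.
case/residual_edgesP=> _ unused _; rewrite /total_weight big_setU1 //.
by apply: contra unused; apply: imset_f.
Qed.

(** The closure assumption gives the edge when [f] has at least two riders; with one rider, the
    nonempty uncovered part is all of [f.2]. *)
Lemma residual_edge_uncovered M f : closed_edges I -> f \in edges I ->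
  f.1 \notin used_drivers M -> uncovered M f != set0 ->
  (f.1, uncovered M f) \in residual_edges M.
Proof.
move=> closed fI unused un0; apply/residual_edgesP; split=> //=; last first.
  by rewrite -setI_eq0 /uncovered setDE setIAC -setIA setICr setI0.
have subf : uncovered M f \subset f.2 by apply: subsetDl.
have [f2_gt1|f2_le1] := ltnP 1 #|f.2|.
  by apply: (closed f.1 f.2) => //; case: (f) fI.
suff -> : uncovered M f = f.2 by case: (f) fI.
by apply/eqP; rewrite eqEcard subf (leq_trans f2_le1) // card_gt0.
Qed.

Lemma capacity_le_max eta : (capacity I eta <= max_capacity I)%N.
Proof. exact: leq_bigmax. Qed.

Lemma weight_bounds e : e \in edges I ->
  min_weight I <= weight I e <= max_weight I.
Proof.
move=> eI; rewrite /min_weight /max_weight.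
case: pickP => [e0 e0I|/(_ e)]; last by rewrite eI.
case: arg_minP => // f _ /(_ e eI) ->.
by case: arg_maxP => // g _ /(_ e eI).
Qed.

Lemma min_weight_attained e : e \in edges I ->
  exists2 f, f \in edges I & min_weight I = weight I f.
Proof.
move=> eI; rewrite /min_weight.
case: pickP => [e0 e0I|/(_ e)]; last by rewrite eI.
by case: arg_minP => // f fI _; exists f.
Qed.

(** Also covers a hypergraph without edges, where the dummy 0 makes the spread 0. *)
Lemma weight_spread_ge0 :
  (forall e, e \in edges I -> 1 <= weight I e) -> 0 <= weight_spread I.
Proof.
move=> weight_ge1; rewrite /weight_spread /max_weight /min_weight.
case: pickP => [e0 e0I|_]; last by rewrite mul0r.
case: arg_maxP => // g /weight_ge1 g_ge1 _.
case: arg_minP => // f /weight_ge1 f_ge1 _.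
by rewrite divr_ge0 // ler0z; [apply: le_trans g_ge1|apply: le_trans f_ge1].
Qed.

End Residual.

(** * The potential of a partial greedy run relative to a feasible solution [N] *)

Section MinWeightGreedy.
Context {D R : finType} (I : instance D R) (N : {set D * {set R}}).
Implicit Types (e f : D * {set R}) (M : {set D * {set R}}).
Hypotheses (closed : closed_edges I) (monotone : monotone_weight I).
Hypothesis N_feasible : feasible I N.

Let L : rat := (max_capacity I)%:R.
Context (a b rho y : rat).
Hypotheses (a_gt0 : 0 < a) (le_ab : a <= b) (L_ge1 : 1 <= L).
Hypotheses (yE : (L + 1) * y = L * b + a) (rhoE : rho * a = L * y).
Hypothesis weight_ab : forall e, e \in edges I -> a <= weight_key I e <= b.

Let le_ay : a <= y. Proof. exact: price_ge_min yE. Qed.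
Let le_yb : y <= b. Proof. exact: price_le_max yE. Qed.

Let NI f : f \in N -> f \in edges I.
Proof. by case: N_feasible => /subsetP sub _ _ /sub. Qed.

Definition slot_price f : rat := Num.max (weight_key I f) y.

(** With the driver free and [u] riders uncovered, this is [u * slot_price f] plus the reserve
    [rho * weight_key I f - L * slot_price f] for losing the driver. Once the driver is used, each
    leftover rider is priced at [b]. *)
Definition share M f : rat :=
  if f.1 \in used_drivers M then b * #|uncovered M f|%:R
  else rho * weight_key I f - (L - #|uncovered M f|%:R) * slot_price f.

Definition potential M : rat := \sum_(f in N) share M f.

Lemma slot_price_le_max f : f \in edges I -> slot_price f <= b.
Proof. by case/weight_ab/andP=> _ fb; rewrite ge_max fb le_yb. Qed.

Lemma slot_price_ge0 f : 0 <= slot_price f.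
Proof. by rewrite le_max orbC (le_trans _ le_ay) // ltW. Qed.

Lemma total_slots_le f : f \in edges I ->
  L * slot_price f <= rho * weight_key I f.
Proof. by case/weight_ab/andP=> le_af _; apply: slot_le_ratio yE rhoE _ _. Qed.

Lemma card_riders_le f : f \in edges I -> #|f.2|%:R <= L :> rat.
Proof.
move=> /edges_capacity fc; rewrite ler_nat.
exact: leq_trans fc (capacity_le_max I f.1).
Qed.

Lemma card_uncovered_le M f : f \in edges I -> #|uncovered M f|%:R <= L :> rat.
Proof.
move=> fI; apply: le_trans (card_riders_le fI).
by rewrite ler_nat subset_leq_card ?subsetDl.
Qed.

Lemma share_ge0 M f : f \in edges I -> 0 <= share M f.
Proof.
move=> fI; rewrite /share; case: ifP => _.
  by rewrite mulr_ge0 // (le_trans _ le_ab) // ltW.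
rewrite subr_ge0 (le_trans _ (total_slots_le fI)) //.
rewrite ler_wpM2r ?slot_price_ge0 //.
by rewrite lerBlDr lerDl.
Qed.

Lemma potential_ge0 M : 0 <= potential M.
Proof. by apply: sumr_ge0 => f /NI; apply: share_ge0. Qed.

Lemma potential0_le : potential set0 <= rho * (total_weight I N)%:~R.
Proof.
rewrite /total_weight rmorph_sum mulr_sumr; apply: ler_sum => f /NI fI.
rewrite /share /used_drivers imset0 inE lerBlDr lerDl.
by rewrite mulr_ge0 ?slot_price_ge0 // subr_ge0 card_uncovered_le.
Qed.

(** * Change of the potential in one greedy step *)

Section Step.
Variables (e : D * {set R}) (M : {set D * {set R}}).
Hypothesis e_residual : e \in residual_edges I M.
Hypothesis e_min : forall f, f \in residual_edges I M ->
  weight_key I e <= weight_key I f.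

Let drop f := share M f - share (e |: M) f.
Let taken f : rat := #|f.2 :&: e.2|%:R.

Let e_edge : e \in edges I. Proof. by case/residual_edgesP: e_residual. Qed.
Let e_unused : e.1 \notin used_drivers M.
Proof. by case/residual_edgesP: e_residual. Qed.
Let uncoveredE f :
  #|uncovered M f|%:R = #|uncovered (e |: M) f|%:R + taken f :> rat.
Proof.
by rewrite -natrD -card_uncoveredU1 //; case/residual_edgesP: e_residual.
Qed.

Let taken_ge0 f : 0 <= taken f. Proof. exact: ler0n. Qed.

Lemma drop_used f : f.1 \in used_drivers M -> drop f = b * taken f.
Proof.
move=> used; rewrite /drop /share used_driversU1 !inE used orbT uncoveredE.
by ring.
Qed.

Lemma drop_spared f : f.1 \notin used_drivers M -> f.1 != e.1 ->
  drop f = taken f * slot_price f.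
Proof.
move=> /negPf unused /negPf spared.
rewrite /drop /share used_driversU1 !inE unused spared uncoveredE /=; ring.
Qed.

(** Pricing the [L - u] slots without an uncovered rider at [b] instead of [slot_price f] only
    lowers the old share, to at least [rho * weight_key I f - (L - u) * b]; [kill_le_ratio] then
    applies. *)
Lemma drop_killed f : f \in edges I -> f.1 = e.1 ->
  weight_key I f - y + b * taken f <= drop f.
Proof.
move=> fI fe; have := card_uncovered_le M fI; rewrite -subr_ge0 => free_ge0.
have /andP[le_af _] := weight_ab fI.
have := ler_wpM2l free_ge0 (slot_price_le_max fI).
have := kill_le_ratio a_gt0 le_ab L_ge1 yE rhoE le_af.
rewrite /drop /share used_driversU1 fe !inE eqxx (negPf e_unused) /=.
rewrite uncoveredE; lra.
Qed.

(** A driver lost with no rider left uncovered only releases the reserve, which is nonnegative. *)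
Lemma drop_ge0 f : f \in edges I ->
  ~~ ((f.1 == e.1) && (uncovered M f != set0)) -> 0 <= drop f.
Proof.
move=> fI; have b_ge0 : 0 <= b by move: a_gt0 le_ab; lra.
have [used _|unused] := boolP (f.1 \in used_drivers M).
  by rewrite drop_used // mulr_ge0.
have [fe|spared _] := eqVneq f.1 e.1; last first.
  by rewrite drop_spared // mulr_ge0 ?slot_price_ge0.
rewrite negbK -cards_eq0 => /eqP un0.
have := uncoveredE f; have := taken_ge0 f; have := total_slots_le fI.
have : 0 <= #|uncovered (e |: M) f|%:R :> rat by [].
rewrite /drop /share used_driversU1 fe !inE eqxx (negPf e_unused) un0 /=.
move: (#|_|%:R) (taken f) => u t u_ge0 slots t_ge0 ut.
have -> : u = 0 by lra.
lra.
Qed.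

Lemma key_le_uncovered f : f \in edges I -> f.1 \notin used_drivers M ->
  uncovered M f != set0 -> weight_key I e <= weight_key I f.
Proof.
move=> fI unused un0.
have res := residual_edge_uncovered closed fI unused un0.
apply: le_trans (e_min res) _; rewrite ler_int; apply: monotone => //=.
  by case/residual_edgesP: res.
exact: subsetDl.
Qed.

(** The first bound pays for [e] outright; the second makes up for the [y] missing in [drop_killed].
    Both come from one covered rider, priced at [b] or at [slot_price f]. *)
Lemma drop_touched f : f \in edges I -> 1 <= taken f -> f.1 != e.1 ->
  weight_key I e <= drop f /\ y <= drop f.
Proof.
move=> fI t_ge1 spared; have /andP[_ le_eb] := weight_ab e_edge.
have [used|unused] := boolP (f.1 \in used_drivers M).
  have le_bd : b <= drop f.
    by rewrite drop_used // ler_peMr //; move: a_gt0 le_ab; lra.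
  by split; apply: le_trans le_bd.
have le_sd : slot_price f <= drop f.
  by rewrite drop_spared // ler_peMl // slot_price_ge0.
split; apply: le_trans le_sd; rewrite le_max ?lexx ?orbT //.
rewrite key_le_uncovered // -cards_eq0 -(eqr_nat rat) uncoveredE.
by move: t_ge1 (ler0n rat #|uncovered (e |: M) f|); lra.
Qed.

Lemma potential_step :
  weight_key I e + potential (e |: M) <= potential M.
Proof.
rewrite -lerBrDr -sumrB -[leRHS]/(\sum_(f in N) drop f).
have [_ Ndisj Ncov] := N_feasible.
have [r re] : exists r, r \in e.2 by apply/set0Pn; apply: edges_nonempty e_edge.
have /exists_inP[f fN rf] := forallP Ncov r.
have fI := NI fN.
have t_ge1 : 1 <= taken f.
  by rewrite ler1n card_gt0; apply/set0Pn; exists r; rewrite inE rf.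
have un_f : uncovered M f != set0.
  rewrite -cards_eq0 -(eqr_nat rat) uncoveredE.
  by move: t_ge1 (ler0n rat #|uncovered (e |: M) f|); lra.
(* Here [f] is the edge of [N] holding a rider of [e]. The only share that might grow is that of an
   edge [g] of [N] which loses its driver to [e] with riders still uncovered. Without such a [g],
   [f] alone pays for [e]. *)
have [/existsP[g /and3P[gN ge un_g]]|none] := boolP
  [exists g, [&& g \in N, g.1 == e.1 & uncovered M g != set0]]; last first.
  have dead g : g \in N -> ~~ ((g.1 == e.1) && (uncovered M g != set0)).
    by move=> gN; move/existsPn/(_ g): none; rewrite gN.
  have spared : f.1 != e.1 by move: (dead f fN); rewrite un_f andbT.
  rewrite (bigD1 f) //= (le_trans (drop_touched fI t_ge1 spared).1) // lerDl.
  by apply: sumr_ge0 => g /andP[gN _]; rewrite drop_ge0 ?dead ?NI.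
have gI := NI gN; move/eqP: ge => ge.
have others h : h \in N -> h != g -> h.1 != e.1.
  by move=> hN hg; have /andP[] := Ndisj h g hN gN hg; rewrite ge.
have drop_others h : h \in N -> h != g -> 0 <= drop h.
  by move=> hN hg; rewrite drop_ge0 ?NI // (negPf (others h hN hg)).
have le_eg : weight_key I e <= weight_key I g.
  by apply: key_le_uncovered; rewrite ?ge.
have drop_g := drop_killed gI ge.
(* The share of [g] drops by at least [weight_key I g - y + b * taken g]. If [f = g], the term
   [b * taken g] is at least [b >= y]; otherwise the drop of [f] supplies [y]. *)
rewrite (bigD1 g) //=; have [fg|fg] := eqVneq f g.
  have rest_ge0 : 0 <= \sum_(h in N | h != g) drop h.
    by apply: sumr_ge0 => h /andP[hN hg]; apply: drop_others.
  have : b <= b * taken g by rewrite -fg ler_peMr //; move: a_gt0 le_ab; lra.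
  by move: rest_ge0 drop_g le_eg le_yb; lra.
rewrite (bigD1 f) /=; last by rewrite fN.
have rest_ge0 : 0 <= \sum_(h in N | (h != g) && (h != f)) drop h.
  by apply: sumr_ge0 => h /and3P[hN hg _]; apply: drop_others.
have [_ le_yf] := drop_touched fI t_ge1 (others f fN fg).
have bt_ge0 : 0 <= b * taken g.
  by rewrite mulr_ge0 //; move: a_gt0 le_ab; lra.
under eq_bigl do rewrite -andbA.
by move: rest_ge0 drop_g le_eg le_yf bt_ge0; lra.
Qed.

End Step.

(** Telescopes [potential_step]; [residual_edgesU1] keeps the current hypergraph residual. *)
Lemma greedy_from_le M M' :
  greedy_from (weight_key I) (residual_edges I M) M M' ->
  (total_weight I M')%:~R + potential M' <=
    (total_weight I M)%:~R + potential M.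
Proof.
move: {-2}(residual_edges I M) (erefl (residual_edges I M)) => E EM run.
elim: run EM => {E M M'} [//|E M e M' _ eE e_min _ IH EM].
rewrite {}EM in eE e_min IH.
apply: (le_trans (IH (residual_edgesU1 I e M))).
rewrite total_weightU1 // intrD addrAC [leRHS]addrC lerD2r.
by rewrite potential_step.
Qed.

Lemma greedy_weight_le M : greedy I (weight_key I) M ->
  (total_weight I M)%:~R <= rho * (total_weight I N)%:~R.
Proof.
rewrite /greedy -(residual_edges0 I) => /greedy_from_le.
rewrite {2}/total_weight big_set0 add0r => le_pot.
apply: le_trans potential0_le; apply: le_trans le_pot.
by rewrite lerDl potential_ge0.
Qed.

End MinWeightGreedy.

(** * The ratio, with [a] and [b] the extreme weights and [N] the optimum *)

Theorem theorem3 (D R : finType) (I : instance D R)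
  (card_designated : #|designated I| = #|[set: R]|)
  (designated_edges : forall (eta : D) (r : R),
     eta \in designated I -> (eta, [set r]) \in edges I)
  (weight_ge1 : forall e : D * {set R}, e \in edges I -> 1 <= weight I e)
  (closed : closed_edges I)
  (monotone : monotone_weight I)
  (lambda_ge2 : (2 <= max_capacity I)%N)
  (M Mstar : {set D * {set R}})
  (M_output : greedy_minDist I M)
  (Mstar_optimal : optimal I Mstar) :
  let lambda : rat := (max_capacity I)%:R in
  let mu : rat := weight_spread I in
  (total_weight I M)%:~R / (total_weight I Mstar)%:~R
    <= (lambda ^+ 2 * mu + lambda) / (lambda + 1).
Proof.
cbv zeta; set lambda : rat := (max_capacity I)%:R; set mu := weight_spread I.
have mu_ge0 : 0 <= mu := weight_spread_ge0 weight_ge1.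
have lambda_ge1 : 1 <= lambda by rewrite ler1n ltnW.
have lambda_ge0 : 0 <= lambda by exact: le_trans lambda_ge1.
have lambda1_gt0 : 0 < lambda + 1 by rewrite ltr_wpDl.
have [N_feasible _] := Mstar_optimal; have [/subsetP NI _ _] := N_feasible.
(* For an empty optimum the denominator is 0, so the quotient is 0 by convention. *)
have [->|[f fN]] := set_0Vmem Mstar.
  rewrite {2}/total_weight big_set0 invr0 mulr0 divr_ge0 ?(ltW lambda1_gt0) //.
  by rewrite addr_ge0 // mulr_ge0 // exprn_ge0.
have fI := NI f fN.
have N_gt0 : 0 < total_weight I Mstar.
  rewrite /total_weight (bigD1 f) //=.
  rewrite ltr_pwDl ?(lt_le_trans _ (weight_ge1 f fI)) //.
  by apply: sumr_ge0 => g /andP[/NI/weight_ge1 g_ge1 _]; apply: le_trans g_ge1.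
rewrite ler_pdivrMr ?ltr0z //.
have [g gI minE] := min_weight_attained fI.
set a : rat := (min_weight I)%:~R; set b : rat := (max_weight I)%:~R.
have a_gt0 : 0 < a by rewrite ltr0z minE (lt_le_trans _ (weight_ge1 g gI)).
have weight_ab e : e \in edges I -> a <= weight_key I e <= b.
  by move/weight_bounds; rewrite !ler_int.
have le_ab : a <= b by have /andP[] := weight_ab f fI; apply: le_trans.
have muE : mu * a = b by rewrite divfK ?gt_eqF.
have lambda1_neq0 : lambda + 1 != 0 by rewrite gt_eqF.
case: M_output => M1 [M2 [greedy1 _ _ ->]].
apply: (@le_trans _ _ (total_weight I M1)%:~R).
  by rewrite ler_int ge_min lexx.
apply: (greedy_weight_le closed monotone N_feasible a_gt0 le_ab lambda_ge1
          (y := (lambda * b + a) / (lambda + 1)) _ _ weight_ab greedy1).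
  by rewrite mulrCA divff ?mulr1.
(* With [b = mu * a], the equation [rho * a = lambda * y] becomes an identity of fractions. *)
rewrite -/lambda -muE; field.
by rewrite lambda1_neq0.
Qed.
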